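(* Let $n\ge 8$ or $n=3$, and let $f:Sym_n\to\mathbb{R}$ be an $(n-2)$-eigenfunction of the Star graph $S_n$. Then $|Supp(f)|\ge 2(n-1)!$. Moreover, $|Supp(f)|=2(n-1)!$ if and only if $f=c\cdot\tilde f$ for some real non-zero constant $c$ and some $\tilde f\in\mathcal{F}$.
   Context: For $n\ge 3$, the Star graph $S_n$ is the Cayley graph on the symmetric group $Sym_n$ with generating set $\{(1\,i): i\in\{2,\ldots,n\}\}$; permutations $x,y$ are adjacent iff $xy^{-1}$ is one of these transpositions. For an eigenvalue $\lambda$ of the adjacency matrix of a graph with vertex set $V$, a $\lambda$-eigenfunction is a function $f:V\to\mathbb{R}$, $f\not\equiv 0$, with $\lambda f(x)=\sum_{y\in N(x)}f(y)$ for all $x\in V$, where $N(x)$ is the set of neighbours of $x$. The support is $Supp(f)=\{x\in V: f(x)\neq 0\}$. For $u\in\{1,\ldots,n\}$ and $v,w\in\{2,\ldots,n\}$ with $v\ne w$, define $f_u^{v,w}:Sym_n\to\mathbb{R}$ by $f_u^{v,w}(\pi)=1$ if $\pi(v)=u$, $f_u^{v,w}(\pi)=-1$ if $\pi(w)=u$, and $0$ otherwise. Let $\mathcal{F}=\{f_u^{v,w}: u\in\{1,\ldots,n\},\ v,w\in\{2,\ldots,n\},\ v\ne w\}$. *)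

(* Defs.v *)
From HB Require Import structures.
From mathcomp Require Import all_boot all_order all_algebra all_fingroup.
From mathcomp Require Import reals.

Set Implicit Arguments.
Unset Strict Implicit.
Unset Printing Implicit Defensive.

Import Order.TTheory GRing.Theory Num.Theory.

Local Open Scope ring_scope.

Definition neighbours (V : finType) (e : rel V) (x : V) : {set V} :=
  [set y | e x y].

(* The non-vanishing of [f] makes [lambda] an eigenvalue of the adjacency
   matrix, so this is not a separate requirement. *)
Definition eigenfunction (R : realType) (V : finType) (e : rel V)
    (lambda : R) (f : V -> R) : Prop :=
  (exists x, f x != 0) /\
  (forall x, lambda * f x = \sum_(y in neighbours e x) f y).

Definition Supp (R : realType) (V : finType) (f : V -> R) : {set V} :=
  [set x | f x != 0].

Definition cayley_graph (gT : finGroupType) (S : {set gT}) : rel gT :=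
  fun x y => (x * y^-1)%g \in S.

(* The points 1, ..., n are represented by 0, ..., n - 1 in ['I_n], so the
   distinguished point 1 is the ordinal of value 0. *)
Definition star_transpositions (n : nat) : {set 'S_n} :=
  [set s | [exists i : 'I_n, exists j : 'I_n,
             [&& val i == 0%N, val j != 0%N & s == tperm i j]]].

(* Products of permutations are read from left to right:
   [(s * t)%g k = t (s k)].  Hence the neighbours of [x] are the permutations
   [k |-> x (t k)] with [t] a star transposition; this is the convention under
   which [star_fun R u v w] below is an eigenfunction for v, w different from
   the distinguished point. *)
Definition star_graph (n : nat) : rel 'S_n :=
  cayley_graph (star_transpositions n).

Definition star_fun (R : realType) (n : nat) (u v w : 'I_n) : 'S_n -> R :=
  fun p => if p v == u then 1 else if p w == u then -1 else 0.

Definition star_family (R : realType) (n : nat) (g : 'S_n -> R) : Prop :=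
  exists u v w : 'I_n,
    [/\ val v != 0%N, val w != 0%N, v != w & g = star_fun R u v w].

(* Main.v *)
(* Comparing [f] with its swap at the distinguished point [o] and a point v, the
   eigenvalue equation gives f x - f (x o (o v)) = q_v(x v) - q_v(x o), whence
   f p = sum_v A v (p v) for a matrix [A] with zero row [o] and zero column sums.
   Swapping two values (or two positions) shows that a small support forces the
   difference of any two rows, and of any two columns, of [A] to be constant up
   to two exceptions when n >= 8. Subtracting constants from rows and columns
   then leaves a constant C plus a matrix [B] that either is close to a multiple
   of a permutation matrix, and then f is non-zero off a coset of a point
   stabiliser, or has at most four non-zero cells. In the latter case counting
   the permutations meeting no cell or exactly one cell gives C = 0 and at most
   two cells: these are opposite and in one column, so f is a multiple of some
   f_u^{v,w}. For n = 3, f p = t (p 1) - t (p 2) directly. *)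

Require Import Defs.
From HB Require Import structures.
From mathcomp Require Import all_boot all_order all_algebra all_fingroup.
From mathcomp Require Import reals.
From mathcomp Require Import ring lra zify.

Set Implicit Arguments.
Unset Strict Implicit.
Unset Printing Implicit Defensive.

Import Order.TTheory GRing.Theory Num.Theory.

Local Open Scope ring_scope.

(** * Counting permutations with prescribed values *)

Lemma card_permT (T : finType) : #|{: {perm T}}| = #|T|`!.
Proof.
rewrite -cardsT -(card_perm [set: T]); apply: eq_card => p.
by rewrite inE unfold_in; apply/esym/subsetP => x _; rewrite inE.
Qed.

Lemma exists_perm2 (T : finType) (a b a' b' : T) :
  a != b -> a' != b' -> exists s : {perm T}, s a = a' /\ s b = b'.
Proof.
move=> ab ab'; exists (tperm a a' * tperm (tperm a a' b) b')%g.
rewrite !permM tpermL; split; last by rewrite tpermL.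
rewrite tpermD 1?eq_sym //.
by rewrite -[X in X != _](tpermL a a') (inj_eq perm_inj).
Qed.

Lemma card_offdiag (T : finType) :
  #|[set c : T * T | c.1 != c.2]| = (#|T| * (#|T| - 1))%N.
Proof.
have -> : [set c : T * T | c.1 != c.2] = ~: [set (x, x) | x in [set: T]].
  apply/setP => -[x y]; rewrite !inE /=; congr negb; apply/eqP/imsetP.
    by move=> ->; exists y; rewrite ?inE.
  by case=> z _ [-> ->].
rewrite cardsCs setCK card_imset; last by move=> x y [].
by rewrite cardsT card_prod; nia.
Qed.

(** Right translation by a suitable permutation carries the fibre of [p |-> (p i, p j)] over one
    off-diagonal pair into the fibre over any other, so with N = [#|T|] every such fibre has N! / (N
    (N - 1)) elements. *)
Lemma card_perm_pairs (T : finType) (i j : T) (P : rel T) : i != j ->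
  #|[set p : {perm T} | P (p i) (p j)]| =
  (#|[set c : T * T | (c.1 != c.2) && P c.1 c.2]| * (#|T| - 2)`!)%N.
Proof.
move=> ij.
pose F a b := #|[set p : {perm T} | (p i == a) && (p j == b)]|.
have F_le c d a b : c != d -> a != b -> (F c d <= F a b)%N.
  move=> cd ab; have [s [sa sb]] := exists_perm2 cd ab.
  rewrite /F -(card_imset _ (mulIg s)); apply/subset_leq_card/subsetP => p.
  case/imsetP => q; rewrite !inE => /andP[/eqP qi /eqP qj] ->.
  by rewrite !permM qi qj sa sb !eqxx.
have split_sum (Q : rel T) : #|[set p : {perm T} | Q (p i) (p j)]| =
    (\sum_(c : T * T | (c.1 != c.2) && Q c.1 c.2) F c.1 c.2)%N.
  rewrite -sum1_card (partition_big (fun p : {perm T} => (p i, p j))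
    (fun c => (c.1 != c.2) && Q c.1 c.2)) /=; last first.
    by move=> p; rewrite inE (inj_eq perm_inj) => ->; rewrite ij.
  apply: eq_bigr => -[a b] /= /andP[_ Qab]; rewrite /F -sum1_card.
  apply: eq_bigl => p; rewrite !inE xpair_eqE.
  by apply: andb_idl => /andP[/eqP-> /eqP->].
have FE : forall a b, a != b -> F a b = (#|T| - 2)`!.
  move=> a b ab; have N1 : (1 < #|T|)%N by apply/card_gt1P; exists i, j.
  have := split_sum (fun _ _ => true).
  have -> : [set p : {perm T} | true] = [set: {perm T}] by apply/setP => p; rewrite !inE.
  rewrite cardsT card_permT.
  rewrite (eq_bigr (fun=> F a b)); last first.
    by move=> c /andP[cd _]; apply/eqP; rewrite eqn_leq !F_le.
  rewrite sum_nat_const.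
  have -> : #|(fun c : T * T => (c.1 != c.2) && true)| = (#|T| * (#|T| - 1))%N.
    by rewrite -card_offdiag; apply: eq_card => c; rewrite !inE unfold_in andbT.
  case: (#|T|) N1 => [|[|n]] // _; rewrite !subSS !subn0 !factS mulnA => /eqP.
  by rewrite eqn_pmul2l // => /eqP.
rewrite split_sum; under eq_bigr => c /andP[cd _] do rewrite FE //.
by rewrite sum_nat_const; congr (_ * _)%N; apply: eq_card => c; rewrite !inE.
Qed.

Lemma card_perm_fiber2 (T : finType) (i j a b : T) : i != j ->
  (#|[set p : {perm T} | (p i == a) && (p j == b)]| <= (#|T| - 2)`!)%N.
Proof.
move=> ij; rewrite (card_perm_pairs (fun x y => (x == a) && (y == b)) ij).
rewrite -[leqRHS]mul1n leq_mul2r; apply/orP; right.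
rewrite -(cards1 (a, b)); apply/subset_leq_card/subsetP => -[x y].
by rewrite !inE xpair_eqE => /andP[].
Qed.

Lemma card_perm_fiber1 (T : finType) (i a : T) :
  #|[set p : {perm T} | p i == a]| = (#|T| - 1)`!.
Proof.
have F_le b c : (#|[set p : {perm T} | p i == b]| <=
    #|[set p : {perm T} | p i == c]|)%N.
  rewrite -(card_imset _ (mulIg (tperm b c))); apply/subset_leq_card/subsetP => p.
  by case/imsetP => q; rewrite !inE => /eqP qi ->; rewrite permM qi tpermL.
have := card_permT T.
rewrite -[X in X = _]sum1_card (partition_big (fun p : {perm T} => p i) predT) //=.
rewrite (eq_bigr (fun=> #|[set p : {perm T} | p i == a]|)); last first.
  move=> b _; rewrite sum1_card.
  have <- : #|[set p : {perm T} | p i == b]| = #|[set p : {perm T} | p i == a]|.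
    by apply/eqP; rewrite eqn_leq !F_le.
  by apply: eq_card => p; rewrite inE unfold_in.
rewrite sum_nat_const.
have: (0 < #|T|)%N by apply/card_gt0P; exists i.
case: (#|T|) => // n _; rewrite factS subn1 => /eqP.
by rewrite eqn_pmul2l // => /eqP.
Qed.

Lemma card_SuppV (R : realType) (T : finType) (f : {perm T} -> R) :
  #|Supp (fun p => f p^-1%g)| = #|Supp f|.
Proof.
rewrite -(card_imset _ invg_inj); apply: eq_card => p.
apply/imsetP/idP => [[q]|]; rewrite !inE; first by move=> fq ->.
by move=> fp; exists p^-1%g; rewrite ?invgK // inE invgK.
Qed.

(** * Swapping two images, and functions with few discordant pairs *)

Definition discordant (T : finType) (R : eqType) (y : T -> R) : {set T * T} :=
  [set c | y c.1 != y c.2].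

(* Swapping the images of [i] and [j] changes [f] by [y (p i) - y (p j)], so of
   the two permutations at least one is in the support if this is non-zero. *)
Lemma row_pair_bound (R : realType) (T : finType) (A : T -> T -> R) (C : R)
    (f : {perm T} -> R) (i j : T) :
  (forall p, f p = C + \sum_v A v (p v)) -> i != j ->
  (#|discordant (fun a => (A i a - A j a)%R)| * (#|T| - 2)`! <= 2 * #|Supp f|)%N.
Proof.
move=> fE ij; pose y a := A i a - A j a.
have swap p : f p - f (tperm i j * p)%g = y (p i) - y (p j).
  rewrite !fE opprD addrACA subrr add0r.
  rewrite (bigD1 i) //= (bigD1 j) 1?eq_sym //= [in X in _ - X](bigD1 i) //=.
  rewrite [in X in _ - X](bigD1 j) 1?eq_sym //= !permM tpermL tpermR.
  under [in X in _ - X]eq_bigr => v /andP[vi vj] do rewrite permM tpermD 1?eq_sym //.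
  by rewrite /y; ring.
have -> : discordant (fun a => A i a - A j a) =
    [set c : T * T | (c.1 != c.2) && (y c.1 != y c.2)].
  apply/setP => -[a b]; rewrite !inE /=; apply/esym/andb_idl.
  by apply: contraNneq => ->.
rewrite -(card_perm_pairs (fun a b => y a != y b) ij).
have /subset_leq_card/leq_trans-> // : [set p : {perm T} | y (p i) != y (p j)]
    \subset Supp f :|: [set (tperm i j * p)%g | p in Supp f].
  apply/subsetP => p; rewrite !inE => yp; rewrite -implyNb negbK.
  apply/implyP => /eqP fp; apply/imsetP; exists (tperm i j * p)%g.
    rewrite inE; apply: contraNneq yp => fp'.
    by rewrite -subr_eq0 -swap fp fp' subrr.
  by rewrite mulgA tperm2 mul1g.
rewrite (leq_trans (leq_card_setU _ _)) // card_imset; last exact: mulgI.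
by rewrite addnn -mul2n.
Qed.

Lemma col_sumE (R : realType) (T : finType) (A : T -> T -> R) (p : {perm T}) :
  \sum_v A v (p v) = \sum_u A (p^-1%g u) u.
Proof. by rewrite (reindex_inj (@perm_inj _ p^-1%g)); under eq_bigr do rewrite permKV. Qed.

(** Inverting the permutation transposes [A] and preserves the size of the support. *)
Lemma col_pair_bound (R : realType) (T : finType) (A : T -> T -> R) (C : R)
    (f : {perm T} -> R) (a b : T) :
  (forall p, f p = C + \sum_v A v (p v)) -> a != b ->
  (#|discordant (fun v => (A v a - A v b)%R)| * (#|T| - 2)`! <= 2 * #|Supp f|)%N.
Proof.
move=> fE ab; rewrite -(card_SuppV f).
apply: (row_pair_bound (A := fun u v => A v u) (C := C)) ab => p.
by rewrite fE col_sumE invgK.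
Qed.

(** Let N = [#|T|]. A level set of size e gives 2 e (N - e) discordant pairs; for 3 <= e <= N - 3
    this is at least 6 (N - 3), which exceeds 4 (N - 1) exactly when N >= 8. If all level sets have
    at most two elements, there are at least N (N - 2) discordant pairs, again too many. *)
Lemma few_exceptions (R : eqType) (T : finType) (y : T -> R) : (8 <= #|T|)%N ->
  (#|discordant y| <= 4 * (#|T| - 1))%N ->
  exists z, (#|[set a | y a != z]| <= 2)%N.
Proof.
move=> N8 dis.
have cC z : #|[set a | y a != z]| = (#|T| - #|[set a | y a == z]|)%N.
  by rewrite cardsCs; congr (_ - _)%N; apply: eq_card => a; rewrite !inE negbK.
case: (boolP [exists a, (2 < #|[set b | y b == y a]|)%N]) => [|/existsPn small].
  case/existsP => a big; exists (y a).
  have : (2 * (#|[set b | y b == y a]| * #|[set b | y b != y a]|) <=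
      4 * (#|T| - 1))%N.
    apply: leq_trans dis.
    set E := [set b | _ == _]; set D := [set b | _ != _].
    have disj : [disjoint setX E D & setX D E].
      rewrite -setI_eq0; apply/eqP/setP => -[b c]; rewrite !inE /=.
      by case: (y b == y a); rewrite ?andbF.
    have -> : (2 * (#|E| * #|D|) = #|setX E D :|: setX D E|)%N.
      by rewrite cardsU disjoint_setI0 // cards0 !cardsX; lia.
    apply/subset_leq_card/subsetP => -[b c]; rewrite !inE /=.
    by case/orP => /andP[]; [move/eqP-> | move=> + /eqP ->] => //; rewrite eq_sym.
  have : (#|[set b | y b == y a]| <= #|T|)%N by rewrite max_card.
  by rewrite cC; nia.
suff: (#|T| * (#|T| - 2) <= 4 * (#|T| - 1))%N by move=> le; exfalso; nia.
apply: leq_trans dis; rewrite -sum1_card.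
rewrite (partition_big (fun c : T * T => c.1) predT) //=.
rewrite -sum_nat_const; apply: leq_sum => a _.
have {}small := small a; rewrite -leqNgt in small.
apply: (@leq_trans #|[set b | y b != y a]|); first by rewrite cC leq_sub2l.
rewrite -(card_imset _ (_ : injective (pair a))); last by move=> b c [].
rewrite sum1_card; apply/subset_leq_card/subsetP => c /imsetP[b + ->].
by rewrite inE unfold_in /= => yb; rewrite inE /= eqxx eq_sym yb.
Qed.

(** * Support sizes from the non-zero cells *)

Definition cells (R : realType) (T : finType) (B : T -> T -> R) : {set T * T} :=
  [set c | B c.1 c.2 != 0].

(* Let [H p] be the number of cells met by [p]. The bounds come from summing
   [1 <= [H = 0] + H] if [C != 0], and [2 H <= [H = 1] + H ^ 2] if [C = 0]. *)
Lemma few_cells (R : realType) (T : finType) (B : T -> T -> R) (C : R)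
    (f : {perm T} -> R) :
  (forall p, f p = C + \sum_v B v (p v)) -> (8 <= #|T|)%N ->
  (#|cells B| + 3 <= #|T|)%N ->
  (#|Supp f| <= 2 * (#|T| - 1)`!)%N ->
  C = 0 /\ (#|cells B| <= 2)%N.
Proof.
move=> fE N8; set M := cells B; move=> mN small.
pose H (p : {perm T}) := #|[set v | B v (p v) != 0]|.
have HE p : H p = (\sum_(c in M) (p c.1 == c.2))%N.
  rewrite -big_mkcondr /= sum1_card /H.
  rewrite -(card_imset _ (_ : injective (fun v => (v, p v)))); last by move=> v w [].
  apply: eq_card => -[v u]; rewrite [RHS]unfold_in inE /=.
  apply/imsetP/andP => [[w + [-> ->]]|[Bvu /eqP pv]]; first by rewrite inE.
  by exists v; rewrite ?inE pv.
have sumH : (\sum_(p : {perm T}) H p = #|M| * (#|T| - 1)`!)%N.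
  under eq_bigr do rewrite HE.
  rewrite exchange_big -sum_nat_const; apply: eq_bigr => c _.
  rewrite -big_mkcond sum1_card -(card_perm_fiber1 c.1 c.2).
  by apply: eq_card => p; rewrite inE.
have sumH2 : (\sum_(p : {perm T}) H p ^ 2 <=
    #|M| * (#|T| - 1)`! + #|M| * ((#|M| - 1) * (#|T| - 2)`!))%N.
  have sqE p : (H p ^ 2 = \sum_(c in M) ((p c.1 == c.2) +
      \sum_(d in M :\ c) (p c.1 == c.2) && (p d.1 == d.2)))%N.
    rewrite -mulnn [in X in (X * _)%N]HE big_distrl; apply: eq_bigr => c cM /=.
    rewrite HE (big_setD1 c) //= mulnDr mulnb andbb big_distrr; congr (_ + _)%N.
    by apply: eq_bigr => d _ /=; rewrite mulnb.
  under eq_bigr do rewrite sqE; rewrite exchange_big /=.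
  under eq_bigr do rewrite big_split /= exchange_big.
  rewrite big_split /= leq_add //.
    rewrite -sum_nat_const; apply: leq_sum => c _.
    rewrite -big_mkcond sum1_card -(card_perm_fiber1 c.1 c.2).
    by apply/eq_leq/eq_card => p; rewrite inE.
  rewrite -sum_nat_const; apply: leq_sum => c cM.
  have -> : (#|M| - 1 = #|M :\ c|)%N by rewrite [in LHS](cardsD1 c M) cM addKn.
  rewrite -sum_nat_const; apply: leq_sum => d; rewrite in_setD1 => /andP[dc _].
  rewrite -big_mkcond sum1_card.
  have [e|ne] := eqVneq c.1 d.1; last first.
    apply: leq_trans (card_perm_fiber2 c.2 d.2 ne).
    by apply/eq_leq/eq_card => p; rewrite inE.
  rewrite eq_card0 // => p; rewrite unfold_in e; apply/negP.
  case/andP=> /eqP-> /eqP cd; case/eqP: dc.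
  by rewrite [LHS]surjective_pairing [RHS]surjective_pairing e cd.
have factN : (#|T|`! = #|T| * ((#|T| - 1) * (#|T| - 2)`!))%N.
  by case: (#|T|) N8 => [|[|n]] // _; rewrite !subSS !subn0 !factS.
have factN1 : ((#|T| - 1)`! = (#|T| - 1) * (#|T| - 2)`!)%N.
  by case: (#|T|) N8 => [|[|n]] // _; rewrite !subSS !subn0 !factS.
have := fact_gt0 (#|T| - 2); move: factN factN1; set F := (_ - 2)`! => factN factN1 F0.
have hit0 p : H p = 0%N -> f p = C.
  move=> /eqP; rewrite cards_eq0 => /eqP/setP H0.
  rewrite fE big1 ?addr0 // => v _; apply/eqP.
  by have := H0 v; rewrite !inE => /negbFE.
have hit1 p : H p = 1%N -> f p != C.
  move=> /eqP/cards1P[v /setP Hv]; rewrite fE -subr_eq0 addrAC subrr add0r.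
  rewrite (bigD1 v) //= big1 ?addr0; first by have := Hv v; rewrite !inE eqxx.
  by move=> w wv; apply/eqP; have := Hv w; rewrite !inE (negbTE wv) => /negbFE.
have C0 : C = 0.
  apply/eqP/negPn/negP => C0.
  have : (#|T|`! <= #|Supp f| + #|M| * (#|T| - 1)`!)%N.
    rewrite -card_permT -sumH -!sum1_card [X in (_ <= X + _)%N]big_mkcond /= -big_split.
    apply: leq_sum => p _; rewrite inE /=.
    have [/hit0 ->|] := posnP (H p); first by rewrite C0.
    by move=> H1; rewrite (leq_trans H1) // leq_addl.
  have : ((#|M| + 3) * (#|T| - 1)`! <= #|T| * (#|T| - 1)`!)%N by rewrite leq_mul2r mN orbT.
  by move: small (fact_gt0 (#|T| - 1)); rewrite factN -factN1 mulnDl; clear; lia.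
split=> //; rewrite leqNgt; apply/negP => m3.
have : (2 * (#|M| * (#|T| - 1)`!) <= #|Supp f| + \sum_(p : {perm T}) H p ^ 2)%N.
  rewrite -sumH -sum1_card [X in (_ <= X + _)%N]big_mkcond /= -big_split big_distrr /=.
  apply: leq_sum => p _; rewrite inE.
  have [/hit1|H1] := eqVneq (H p) 1%N; last first.
    by apply: leq_trans (leq_addl _ _); case: (H p) H1 => [|[|h]] // _; clear; nia.
  by rewrite C0 => ->; case: (H p) => [|h] //; clear; nia.
move=> le1; have {le1} le2 := leq_trans le1 (leq_add small sumH2).
have {le2} : (#|M| * (#|T| - 1) <= 2 * (#|T| - 1) + #|M| * (#|M| - 1))%N.
  rewrite -(leq_pmul2r F0); move: le2; rewrite factN1; clear.
  by rewrite mulnDl -!mulnA; lia.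
(* What remains is (m - 2)(N - 1) <= m (m - 1), impossible for 3 <= m <= N - 3: if m >= 5 because N
   - 1 >= m + 2, if m is 3 or 4 because N >= 8. *)
move: m3 mN N8; clear; move: #|M| #|T| => m N m3 mN N8.
have [k Nk] : exists k, N = (m + 3 + k)%N by exists (N - (m + 3))%N; lia.
have [l ml] : exists l, m = (3 + l)%N by exists (m - 3)%N; lia.
subst m N; clear -N8; nia.
Qed.

Lemma card_Supp_star (R : realType) (n : nat) (u v w : 'I_n) : v != w ->
  #|Supp (star_fun R u v w)| = (2 * (n - 1)`!)%N.
Proof.
move=> vw.
have -> : Supp (star_fun R u v w) =
    [set p : 'S_n | p v == u] :|: [set p : 'S_n | p w == u].
  apply/setP => p; rewrite !inE /star_fun; case: (p v == u); first by rewrite oner_eq0.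
  by case: (p w == u); rewrite ?oppr_eq0 ?oner_eq0 ?eqxx.
rewrite cardsU [_ :&: _](_ : _ = set0) ?cards0 ?subn0.
  by rewrite !card_perm_fiber1 card_ord mul2n addnn.
apply/setP => p; rewrite !inE; apply/negP => /andP[/eqP pv /eqP pw].
by case/eqP: vw; apply: (@perm_inj _ p); rewrite pv pw.
Qed.

(** * Additive form of the eigenfunctions *)

(** This is the Dirichlet form of the Cayley graph generated by the [tperm v i]. After expanding the
    squares, the eigenvalue equation evaluates the cross terms, and translation invariance the
    shifted squares. *)
Lemma transposition_sum_energy (R : realType) (T : finType) (v : T) (D : pred T)
    (mu : R) (g : {perm T} -> R) :
  (forall x, \sum_(i | D i) g (tperm v i * x)%g = mu * g x) ->
  \sum_x \sum_(i | D i) (g x - g (tperm v i * x)%g) ^+ 2 =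
  2 * (#|D|%:R - mu) * \sum_x g x ^+ 2.
Proof.
move=> eig; pose S := \sum_x g x ^+ 2; rewrite -/S.
have shift : \sum_x \sum_(i | D i) g (tperm v i * x)%g ^+ 2 = #|D|%:R * S.
  rewrite exchange_big /= mulr_natl -sumr_const; apply: eq_bigr => i _.
  by rewrite [S](reindex_inj (mulgI (tperm v i))).
transitivity (\sum_x (#|D|%:R * g x ^+ 2 - 2 * mu * g x ^+ 2 +
    \sum_(i | D i) g (tperm v i * x)%g ^+ 2)).
  apply: eq_bigr => x _; under eq_bigr do rewrite sqrrB.
  rewrite big_split sumrB /= sumr_const mulr_natl; congr (_ - _ + _).
  rewrite sumrMnl -mulr_sumr eig; ring.
rewrite big_split sumrB /= -!mulr_sumr shift -/S; ring.
Qed.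

Lemma transposition_sum_invariant (R : realType) (T : finType) (v : T)
    (D : pred T) (g : {perm T} -> R) :
  (forall x, \sum_(i | D i) g (tperm v i * x)%g = #|D|%:R * g x) ->
  forall x i, D i -> g (tperm v i * x)%g = g x.
Proof.
move=> /transposition_sum_energy; rewrite subrr mulr0 mul0r => /eqP.
rewrite psumr_eq0; last by move=> x _; apply: sumr_ge0 => i _; apply: sqr_ge0.
move=> /allP E x i Di; have /= := E x (mem_index_enum x).
rewrite psumr_eq0; last by move=> j _; apply: sqr_ge0.
move=> /allP/(_ i (mem_index_enum i)); rewrite Di sqrf_eq0 subr_eq0 /=.
by move=> /eqP.
Qed.

(** The energy is non-negative, but its factor [#|D|%:R - mu] is negative. *)
Lemma transposition_sum_lt (R : realType) (T : finType) (v : T)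
    (D : pred T) (mu : R) (g : {perm T} -> R) : #|D|%:R < mu ->
  (forall x, \sum_(i | D i) g (tperm v i * x)%g = mu * g x) ->
  forall x, g x = 0.
Proof.
move=> Dmu /transposition_sum_energy energy x.
have S0 : 0 <= \sum_x g x ^+ 2 by apply: sumr_ge0 => y _; apply: sqr_ge0.
have : 0 <= \sum_x \sum_(i | D i) (g x - g (tperm v i * x)%g) ^+ 2.
  by apply: sumr_ge0 => y _; apply: sumr_ge0 => i _; apply: sqr_ge0.
rewrite energy => E; have : \sum_x g x ^+ 2 = 0.
  by apply/eqP; rewrite eq_le S0 andbT; nra.
move/eqP; rewrite psumr_eq0; last by move=> y _; apply: sqr_ge0.
by move=> /allP/(_ x (mem_index_enum x)); rewrite sqrf_eq0 /= => /eqP.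
Qed.

(** The transpositions at [v] avoiding [o] generate the stabiliser of [o]: conjugating them gives
    every transposition fixing [o], and such swaps turn [x] into [y] by induction on the number of
    disagreements. *)
Lemma function_of_value (U : Type) (T : finType) (o v : T) (g : {perm T} -> U) :
  v != o -> (forall x i, (i != o) && (i != v) -> g (tperm v i * x)%g = g x) ->
  forall x y : {perm T}, x o = y o -> g x = g y.
Proof.
move=> vo g_star.
have g_tperm x j k : j != o -> k != o -> g (tperm j k * x)%g = g x.
  move=> jo ko; have [->|jv] := eqVneq j v.
    have [->|kv] := eqVneq k v; first by rewrite tperm1 mul1g.
    by rewrite g_star ?ko.
  have [->|kv] := eqVneq k v; first by rewrite tpermC g_star ?jo.
  have [->|jk] := eqVneq j k; first by rewrite tperm1 mul1g.
  have -> : tperm j k = (tperm v j * (tperm v k * tperm v j))%g.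
    by rewrite -{1}[tperm v j]tpermV -[RHS]/(tperm v k ^ tperm v j)%g tpermJ
       tpermL tpermD // eq_sym.
  by rewrite -!mulgA !g_star ?jo ?ko.
move=> x y; have [n] := ubnP #|[set k | x k != y k]|.
elim: n x => // n IH x le_n xy.
have [->//|xney] := eqVneq x y; have [k xk] : exists k, x k != y k.
  apply/existsP; rewrite -negb_forall; apply: contra xney => /forallP E.
  by apply/eqP/permP => k; apply/eqP.
have ko : k != o by apply: contraNneq xk => ->; rewrite xy.
(* Swapping positions [j] and [k] makes [x] agree with [y] at [k], and no agreement is lost at [j],
   since [x j = y k] differs from [y j]. *)
pose j := (x^-1)%g (y k); have xj : x j = y k by rewrite permKV.
have jo : j != o.
  by apply: contraNneq ko => jo; apply/eqP/(@perm_inj _ y); rewrite -xy -jo xj.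
have jk : j != k by apply: contraNneq xk => jk; rewrite -{1}jk xj.
rewrite -(g_tperm x j k jo ko); apply: IH; last by rewrite permM tpermD.
apply: leq_trans (_ : #|[set k | x k != y k]| <= _)%N; last by rewrite -ltnS.
apply: proper_card; apply/properP; split; last first.
  by exists k; rewrite !inE // permM tpermR xj eqxx.
apply/subsetP => i; rewrite !inE permM.
case: tpermP => [->|->|//]; last by rewrite xj eqxx.
by move=> _; rewrite xj; apply: contraNneq jk => /perm_inj ->.
Qed.

Lemma tperm_star_conj (T : finType) (o v i : T) : v != o -> i != o -> i != v ->
  (tperm o v * tperm v i = tperm o i * tperm o v)%g.
Proof.
move=> vo io iv; rewrite [RHS]conjgC tpermJ tpermL tpermD // 1?eq_sym //.
Qed.

(* The degenerate affine Hecke relation [s J = J' s + 1], where [J] is the sum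
   of the transpositions at [o], [s = tperm o v] and [J'] is the sum of the
   other transpositions at [v], makes [s (lam - J') f - f] an eigenfunction of
   [J'] for its largest eigenvalue [lam]. *)
Lemma star_eigen_swap (R : realType) (T : finType) (o v : T) (f : {perm T} -> R) :
  v != o ->
  (forall x, \sum_(i | i != o) f (tperm o i * x)%g = (#|T|%:R - 2) * f x) ->
  exists q : T -> R, forall x, f x - f (tperm o v * x)%g = q (x v) - q (x o).
Proof.
move=> vo eig; pose s := tperm o v; pose D := [pred i | (i != o) && (i != v)].
pose lam : R := #|D|%:R.
have cardT : #|T|%:R = lam + 2.
  rewrite /lam -natrD (cardD1 o) (cardD1 v) !inE vo /= addnA addnC.
  congr (_ + _)%:R; apply: eq_card => i; by rewrite !inE andbT andbC.
have {}eig x : \sum_(i | i != o) f (tperm o i * x)%g = lam * f x.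
  by rewrite eig cardT; congr (_ * _); ring.
have ssx x : (s * (s * x) = x)%g by rewrite mulgA tperm2 mul1g.
have eig' x : \sum_(i | D i) f (tperm o i * x)%g = lam * f x - f (s * x)%g.
  by rewrite -eig [in RHS](bigD1 v) //= addrAC subrr add0r.
have J'sE x : \sum_(i | D i) f (s * (tperm v i * x))%g = lam * f (s * x)%g - f x.
  rewrite -[in RHS](ssx x) ssx -eig'; apply: eq_bigr => i /andP[io iv].
  by rewrite !mulgA tperm_star_conj.
have D_neq i : D i -> [/\ i != o & i != v] by case/andP.
(* Conjugation by [tperm v i], which fixes [o], permutes the transpositions at [o]; so J and J'
   commute. *)
have JJ' x : \sum_(i | D i) \sum_(j | j != o) f (tperm v i * (tperm o j * x))%g =
    lam * \sum_(i | D i) f (tperm v i * x)%g.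
  rewrite mulr_sumr; apply: eq_bigr => i /D_neq[io iv].
  rewrite -eig (reindex_inj (@perm_inj _ (tperm v i))).
  apply: eq_big => j; first by rewrite -{1}(tpermD vo io) (inj_eq perm_inj).
  move=> _; congr f; rewrite !mulgA; congr (_ * _)%g.
  by rewrite [RHS]conjgC tpermJ (tpermD vo io).
pose g x := lam * f (s * x)%g - \sum_(i | D i) f (tperm v i * (s * x))%g - f x.
have g_eig x : \sum_(j | D j) g (tperm v j * x)%g = #|D|%:R * g x.
  rewrite !sumrB -mulr_sumr J'sE -/lam.
  have -> : \sum_(j | D j) \sum_(i | D i) f (tperm v i * (s * (tperm v j * x)))%g =
      lam * (\sum_(i | D i) f (tperm v i * (s * x))%g) -
      \sum_(i | D i) f (tperm v i * x)%g.
    rewrite exchange_big /= -JJ' -sumrB; apply: eq_bigr => i _.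
    rewrite [in RHS](bigD1 v) //= ssx addrAC subrr add0r.
    apply: eq_bigr => j /D_neq[jo jv]; congr (f (_ * _)%g).
    by rewrite mulgA tperm_star_conj // mulgA.
  rewrite /g; ring.
have g_val := function_of_value vo (transposition_sum_invariant g_eig).
pose psi a := g (tperm o a).
have gE x : g x = psi (x o) by apply: g_val; rewrite tpermL.
pose Psi := \sum_a psi a.
(* [e] is an eigenfunction of J' for lam + 1, which exceeds the number lam of transpositions in J',
   so it vanishes. The constant [Psi] absorbs the sum of the [psi (x i)] over [D]; adding [e] at 1
   and at [s] shows that it is 0. *)
pose e x := (lam + 2) * (f x - f (s * x)%g) - psi (x v) + psi (x o) - Psi.
have e0 x : e x = 0.
  apply: (@transposition_sum_lt _ _ v D (lam + 1)); first by rewrite ltrDl.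
  move=> {}x; rewrite sumrB big_split sumrB /= -mulr_sumr sumrB J'sE.
  have -> : \sum_(i | D i) f (tperm v i * x)%g = lam * f x - f (s * x)%g - psi (x v).
    have := gE (s * x)%g; rewrite /g ssx permM tpermL => <-; ring.
  have -> : \sum_(i | D i) psi ((tperm v i * x)%g v) = Psi - psi (x o) - psi (x v).
    have -> : Psi = psi (x o) + (psi (x v) + \sum_(i | D i) psi (x i)).
      rewrite /Psi (reindex_inj (@perm_inj _ x)) /= (bigD1 o) //=.
      by rewrite [X in _ + X](bigD1 v).
    under eq_bigr do rewrite permM tpermL; ring.
  have -> : \sum_(i | D i) psi ((tperm v i * x)%g o) = lam * psi (x o).
    rewrite /lam mulr_natl -sumr_const; apply: eq_bigr => i /D_neq[io iv].
    by rewrite permM tpermD.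
  rewrite sumr_const -mulr_natl -/lam /e; ring.
have Psi0 : Psi = 0.
  have := e0 1%g; have := e0 (s * 1)%g; rewrite /e ssx !permM !perm1 tpermL tpermR; lra.
exists (fun a => psi a / (lam + 2)) => x.
have := e0 x; rewrite /e Psi0 subr0 => ex.
have lam2 : lam + 2 != 0 by rewrite gt_eqF // ltr_wpDl ?ler0n.
by apply: (mulfI lam2); rewrite -mulrBl [RHS]mulrC divfK //; lra.
Qed.

(** Summing the swap identity over all [v != o] leaves f with coefficient (N - 1) - (N - 2) = 1, so
    f x is the sum of the [q v (x v)] minus [Q (x o)]. Putting this back into a single swap gives
    [Q (x v) = Q (x o)]; the constant [Q] is then spread evenly over the rows other than [o]. *)
Lemma star_eigen_additive (R : realType) (T : finType) (o : T) (f : {perm T} -> R) :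
  (1 < #|T|)%N ->
  (forall x, \sum_(i | i != o) f (tperm o i * x)%g = (#|T|%:R - 2) * f x) ->
  exists A : T -> T -> R,
    [/\ forall u, A o u = 0, forall u, \sum_v A v u = 0 &
        forall x, f x = \sum_v A v (x v)].
Proof.
move=> N1 eig.
have [q qE] : exists q : T -> T -> R, forall v, v != o ->
    forall x, f x - f (tperm o v * x)%g = q v (x v) - q v (x o).
  apply: (@fin_all_exists T (fun=> T -> R) (fun v qv => v != o -> forall x,
    f x - f (tperm o v * x)%g = qv (x v) - qv (x o))) => v.
  have [->|vo] := eqVneq v o; first by exists (fun=> 0).
  by have [qv qvE] := star_eigen_swap vo eig; exists qv.
pose n1 : R := (#|T| - 1)%:R.
have n1E : n1 = #|T|%:R - 1 by rewrite /n1 natrB // ltnW.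
have n10 : n1 != 0 by rewrite pnatr_eq0 subn_eq0 -ltnNge.
have card_o : #|[pred v | v != o]| = (#|T| - 1)%N by rewrite cardC1 subn1.
pose Q a := \sum_(v | v != o) q v a.
have fE x : f x = \sum_(v | v != o) q v (x v) - Q (x o).
  rewrite -sumrB; under eq_bigr => v vo do rewrite -qE //.
  by rewrite sumrB eig sumr_const card_o -[f x *+ _]mulr_natl -/n1 n1E; ring.
have Qconst a b : Q a = Q b.
  have [->//|ab] := eqVneq a b.
  have [v vo] : exists v, v != o.
    have /card_gt1P[v [w [_ _ vw]]] := N1.
    by have [<-|] := eqVneq v o; [exists w; rewrite eq_sym | exists v].
  have [x [xo xv]] : exists x : {perm T}, x o = a /\ x v = b.
    by apply: exists_perm2 => //; rewrite eq_sym.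
  have := qE v vo x; rewrite !fE permM tpermL xo xv (bigD1 v) //=.
  rewrite [X in _ - (X - _)](bigD1 v) //= permM tpermR xo.
  under [X in _ - (_ + X - _)]eq_bigr => w /andP[wo wv] do rewrite permM tpermD 1?eq_sym //.
  rewrite xv; lra.
exists (fun v u => if v == o then 0 else q v u - Q o / n1); split.
- by move=> u; rewrite eqxx.
- move=> u; rewrite (bigD1 o) //= eqxx add0r.
  under eq_bigr => v vo do rewrite (negbTE vo).
  by rewrite sumrB sumr_const card_o -mulr_natl -/n1 mulrCA divff // mulr1 -(Qconst u) subrr.
- move=> x; rewrite (bigD1 o) //= eqxx add0r.
  under eq_bigr => v vo do rewrite (negbTE vo).
  by rewrite sumrB sumr_const card_o -mulr_natl -/n1 mulrCA divff // mulr1 fE (Qconst _ o).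
Qed.

(** * Classification of small supports on at least eight points *)

Lemma card_le2_contra (T : finType) (S : {set T}) (a b c : T) :
  (#|S| <= 2)%N -> a \in S -> b \in S -> c \in S ->
  a != b -> a != c -> b != c -> False.
Proof.
move=> S2 aS bS cS ab ac bc; move: S2; rewrite leqNgt => /negP; apply.
by apply/card_gt2P; exists a, b, c; split; split; rewrite // eq_sym.
Qed.

Lemma avoid_three (T : finType) (S1 S2 S3 : {set T}) : (7 <= #|T|)%N ->
  (#|S1| <= 2)%N -> (#|S2| <= 2)%N -> (#|S3| <= 2)%N ->
  exists a, [/\ a \notin S1, a \notin S2 & a \notin S3].
Proof.
move=> N7 le1 le2 le3; have : S1 :|: S2 :|: S3 != [set: T].
  apply: contraTneq N7 => E; rewrite -ltnNge -cardsT -E.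
  have := leq_of_leqif (leq_card_setU (S1 :|: S2) S3).
  have := leq_of_leqif (leq_card_setU S1 S2); lia.
rewrite -subTset => /subsetPn[a _]; rewrite !inE !negb_or => /andP[/andP[a1 a2] a3].
by exists a.
Qed.

(** Three exceptional sets of size at most two cannot cover seven points, and a point outside all of
    them forces [z = 0]. *)
Lemma sparse_sub_const (R : realType) (T : finType) (y1 y2 : T -> R) (z : R) :
  (7 <= #|T|)%N -> (#|[set a | y1 a != 0%R]| <= 2)%N ->
  (#|[set a | y2 a != 0%R]| <= 2)%N ->
  (#|[set a | (y1 a - y2 a)%R != z]| <= 2)%N ->
  (#|[set a | y1 a != y2 a]| <= 2)%N.
Proof.
move=> N7 w1 w2 w12; have [a] := avoid_three N7 w1 w2 w12.
rewrite !inE !negbK => -[/eqP y1a /eqP y2a /eqP za].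
move: w12; rewrite -za y1a y2a subrr.
by congr (_ <= _)%N; apply: eq_card => b; rewrite !inE subr_eq0.
Qed.

Section SmallSupport.

Variables (R : realType) (T : finType).
Implicit Types (A B : T -> T -> R) (C : R) (f : {perm T} -> R).
Hypothesis N8 : (8 <= #|T|)%N.

Lemma discordant_small (S : finType) (f : S -> R) (y : T -> R) :
  (#|Supp f| <= 2 * (#|T| - 1)`!)%N ->
  (#|discordant y| * (#|T| - 2)`! <= 2 * #|Supp f|)%N ->
  exists z, (#|[set a | y a != z]| <= 2)%N.
Proof.
move=> small dis; apply: few_exceptions => //.
rewrite -(leq_pmul2r (fact_gt0 (#|T| - 2))); apply: leq_trans dis _.
have factN1 : ((#|T| - 1)`! = (#|T| - 1) * (#|T| - 2)`!)%N.
  by case: (#|T|) N8 => [|[|n]] // _; rewrite !subSS !subn0 !factS.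
by move: small; rewrite factN1; clear; lia.
Qed.

Lemma row_differences A C f : (forall p, f p = C + \sum_v A v (p v)) ->
  (#|Supp f| <= 2 * (#|T| - 1)`!)%N ->
  forall i j, exists z, (#|[set u | (A i u - A j u)%R != z]| <= 2)%N.
Proof.
move=> fE small i j; have [->|ij] := eqVneq i j; last first.
  exact: discordant_small small (row_pair_bound fE ij).
by exists 0; rewrite eq_card0 // => u; rewrite inE subrr eqxx.
Qed.

Lemma column_differences A C f : (forall p, f p = C + \sum_v A v (p v)) ->
  (#|Supp f| <= 2 * (#|T| - 1)`!)%N ->
  forall a b, exists z, (#|[set v | (A v a - A v b)%R != z]| <= 2)%N.
Proof.
move=> fE small a b; have [->|ab] := eqVneq a b; last first.
  exact: discordant_small small (col_pair_bound fE ab).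
by exists 0; rewrite eq_card0 // => u; rewrite inE subrr eqxx.
Qed.

(* The matrices surviving the row test here are, up to a multiple, a permutation
   matrix with one further column filled with a small constant; all values of [f]
   off a stabiliser are then non-zero for divisibility reasons. *)
Lemma nonzero_constant_large_Supp (o : T) B C f :
  (forall p, f p = C + \sum_v B v (p v)) ->
  (forall u, B o u = 0) -> (forall u, \sum_v B v u = - C) -> C != 0 ->
  (forall i, #|[set u | B i u != 0%R]| <= 2)%N ->
  (forall i j, #|[set u | B i u != B j u]| <= 2)%N ->
  (2 * (#|T| - 1)`! < #|Supp f|)%N.
Proof.
move=> fE Bo Bsum C0 wt dist.
have row3 i a b c : B i a != 0 -> B i b != 0 -> B i c != 0 ->
    a != b -> a != c -> b != c -> False.
  by move=> *; apply: (card_le2_contra (wt i) (a := a) (b := b) (c := c)); rewrite ?inE.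
have dist3 i j a b c : B i a != B j a -> B i b != B j b -> B i c != B j c ->
    a != b -> a != c -> b != c -> False.
  by move=> *; apply: (card_le2_contra (dist i j) (a := a) (b := b) (c := c)); rewrite ?inE.
(* Every column has non-zero sum, so a row [w u] with a non-zero entry can be chosen in each column
   [u]. *)
have [w w_nz] : exists w, forall u, B (w u) u != 0.
  apply: (@fin_all_exists T (fun=> T) (fun u v => B v u != 0)) => u.
  apply/existsP.
  apply: contraNT C0 => /existsPn Z; rewrite -oppr_eq0 -(Bsum u) big1 // => v _.
  by apply/eqP; have := Z v; rewrite negbK.
have [v [e [e' [ee' Bve Bve' Bv0 share]]]] : exists v e e', [/\ e != e',
    B v e != 0, B v e' != 0, forall c, c != e -> c != e' -> B v c = 0 &
    forall c, c != e -> c != e' -> B (w c) e = B v e].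
  (* An injective [w] would be onto and reach the zero row [o]. So some row [v] is chosen twice and
     is supported on [d] and [d']. *)
  have /injectivePn[d [d' dd' wd]] : ~~ injectiveb w.
    apply/negP => /injectiveP /injF_bij[w' _ w'K].
    by have := w_nz (w' o); rewrite w'K Bo eqxx.
  set v := w d; have Bvd : B v d != 0 by apply: w_nz.
  have Bvd' : B v d' != 0 by rewrite /v wd w_nz.
  have Bv0 c : c != d -> c != d' -> B v c = 0.
    move=> cd cd'; apply/eqP/negPn/negP => Bvc.
    by apply: (row3 v d d' c); rewrite // eq_sym.
  (* Rows [w c] and [v] already differ at [c], so they agree at [d] or at [d']. Below, one of these
     columns is shown to serve for all [c]. *)
  have shared c : c != d -> c != d' -> B (w c) d = B v d \/ B (w c) d' = B v d'.
    move=> cd cd'; have [|ne] := eqVneq (B (w c) d) (B v d); first by left.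
    right; apply/eqP/negPn/negP => ne'; apply: (dist3 (w c) v d d' c) => //.
    - by rewrite Bv0 // w_nz.
    - by rewrite eq_sym.
    - by rewrite eq_sym.
  have [/existsP[c1 /and3P[c1d c1d' ne1]]|/existsPn all_d] :=
      boolP [exists c, [&& c != d, c != d' & B (w c) d != B v d]]; last first.
    exists v, d, d'; split=> // c cd cd'; apply/eqP.
    by have := all_d c; rewrite cd cd' negbK.
  have w1d' : B (w c1) d' = B v d'.
    by case: (shared c1 c1d c1d') => // E; rewrite E eqxx in ne1.
  exists v, d', d; split=> //; [by rewrite eq_sym | by move=> c ? ?; apply: Bv0 |].
  move=> c cd' cd; have [wcd|//] := shared c cd cd'.
  apply/eqP/negPn/negP => ne; have cc1 : c != c1.
    by apply: contraNneq ne1 => <-; rewrite wcd.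
  have wc1 : B (w c) c1 = 0.
    apply/eqP/negPn/negP => nz; apply: (row3 (w c) c d c1); rewrite ?w_nz ?wcd //.
    by rewrite eq_sym.
  apply: (dist3 (w c) (w c1) c1 d d'); rewrite // ?wc1 ?wcd ?w1d' //.
    by rewrite eq_sym w_nz.
  by rewrite eq_sym.
set s := B v e in Bve share.
(* [phi] is a bijection from columns to rows sending [e'] to [o]; for [x != e'] the row [phi x] has
   entry [s] in column [e] and exactly one other non-zero entry, in column [kap x]. *)
pose phi x := if x == e' then o else if x == e then v else w x.
pose kap x := if x == e then e' else x.
have phi_e x : x != e' -> B (phi x) e = s.
  rewrite /phi => xe'; rewrite (negbTE xe').
  by have [_|xe] := eqVneq x e; rewrite ?share.
have phi_kap x : x != e' -> B (phi x) (kap x) != 0.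
  rewrite /phi /kap => xe'; rewrite (negbTE xe').
  by have [_|xe] := eqVneq x e; rewrite ?w_nz.
have kap_e x : kap x != e by rewrite /kap; have [_|//] := eqVneq x e; rewrite eq_sym.
have kap_inj x y : x != e' -> y != e' -> kap x = kap y -> x = y.
  rewrite /kap => xe' ye'; case: eqP => [->|_]; case: eqP => [->|_] // E.
    by rewrite -E eqxx in ye'.
  by rewrite E eqxx in xe'.
have phi_supp x c : x != e' -> c != e -> B (phi x) c != 0 -> c = kap x.
  move=> xe' ce nz; apply/eqP/negPn/negP => ck.
  by apply: (row3 (phi x) c e (kap x)); rewrite ?phi_e ?phi_kap // eq_sym.
have phi_o x : phi x = o -> x = e'.
  move=> E; apply/eqP/negPn/negP => xe'.
  by have := Bve; rewrite -(phi_e x xe') E Bo eqxx.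
have phi_inj : injective phi.
  move=> x y E; have [xe'|xe'] := eqVneq x e'.
    by rewrite xe'; apply/esym/phi_o; rewrite -E xe' /phi eqxx.
  have [ye'|ye'] := eqVneq y e'.
    by case/eqP: xe'; apply: phi_o; rewrite E ye' /phi eqxx.
  by apply: kap_inj => //; apply: phi_supp; rewrite ?kap_e // -E phi_kap.
have phi_onto i : i != o -> exists2 x, x != e' & i = phi x.
  move=> io; have [phi' _ phiK] := injF_bij phi_inj.
  exists (phi' i); last by rewrite phiK.
  by apply: contraNneq io => E; rewrite -(phiK i) E /phi eqxx.
have nz_o i c : B i c != 0 -> i != o by apply: contraNneq => ->; rewrite Bo.
(* By injectivity of [kap], a column other than [e] has only one non-zero entry, which must be its
   sum [- C]. *)
have B_vals i c : c != e -> B i c = - C *+ (B i c != 0).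
  move=> ce; have [->//|nz] := eqVneq (B i c) 0; rewrite -(Bsum c) (bigD1 i) //= big1 ?addr0 //.
  move=> j ji; apply/eqP/negPn/negP => nzj; case/eqP: ji.
  have [x xe' ix] := phi_onto _ (nz_o _ _ nz); have [y ye' jy] := phi_onto _ (nz_o _ _ nzj).
  rewrite ix jy in nz nzj *; congr phi; apply: kap_inj => //.
  by rewrite -(phi_supp _ _ ye' ce nzj) -(phi_supp _ _ xe' ce nz).
have s_C : (#|T| - 1)%:R * s = - C.
  rewrite -(Bsum e) (bigD1 o) //= Bo add0r.
  rewrite (eq_bigr (fun=> s)); last by move=> i /phi_onto[x xe' ->]; rewrite phi_e.
  by rewrite sumr_const cardC1 subn1 mulr_natl.
(* The cell of [p] in column [e] contributes [s] and the others a multiple [- C *+ k]. If f p were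
   0, multiplying by N - 1 would give N - 1 = (N - 1) k + 1. *)
have f_nz (p : {perm T}) : p o != e -> f p != 0.
  move=> poe; pose i0 := (p^-1)%g e; have pi0 : p i0 = e by rewrite permKV.
  have i0o : i0 != o by apply: contraNneq poe => <-; rewrite pi0.
  have [k kE] : exists k : nat, \sum_(i | i != i0) B i (p i) = - C *+ k.
    exists (\sum_(i | i != i0) (B i (p i) != 0%R))%N; rewrite -sumrMnr.
    apply: eq_bigr => i ii0; apply: B_vals.
    by apply: contraNneq ii0 => pie; apply/eqP/(@perm_inj _ p); rewrite pi0.
  rewrite fE (bigD1 i0) //= pi0 kE.
  have [x xe' ->] := phi_onto _ i0o; rewrite phi_e //.
  apply/eqP => E; have : C * (#|T| - 1)%:R = C * ((#|T| - 1) * k + 1)%:R.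
    have sE : s = C * k%:R - C by move: E; rewrite -[- C *+ k]mulr_natr; lra.
    by move: s_C; rewrite sE natrD natrM; move: ((#|T| - 1)%:R : R) => n1; lra.
  move/(mulfI C0)/eqP; rewrite eqr_nat => /eqP; clear -N8.
  by case: k => [|k]; nia.
have : (#|[set p : {perm T} | p o != e]| <= #|Supp f|)%N.
  by apply/subset_leq_card/subsetP => p; rewrite !inE; apply: f_nz.
have <- : #|~: [set p : {perm T} | p o == e]| = #|[set p : {perm T} | p o != e]|.
  by apply: eq_card => p; rewrite !inE.
rewrite cardsCs setCK card_permT card_perm_fiber1 => /(leq_trans _); apply.
have := fact_gt0 (#|T| - 1); case: (#|T|) N8 => [|n] // N7; rewrite factS subn1 /=.
by move: (n`!) => F F0; nia.
Qed.

(** Otherwise each of the N columns, having sum zero, contains two non-zero entries, while the N - 1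
    rows other than [o] contain at most two each. *)
Lemma zero_column (o : T) B :
  (forall u, B o u = 0) -> (forall u, \sum_v B v u = 0) ->
  (forall i, #|[set u | B i u != 0%R]| <= 2)%N -> exists a, forall v, B v a = 0.
Proof.
move=> Bo Bsum wt.
have [/existsP[a /forallP Ba]|/existsPn nz] := boolP [exists a, forall v, B v a == 0].
  by exists a => v; apply/eqP.
have col2 u : (2 <= #|[set v | B v u != 0%R]|)%N.
  have /forallPn[i Biu] := nz u.
  have [/existsP[j /andP[ji Bju]]|/existsPn Z] := boolP [exists j, (j != i) && (B j u != 0)].
    by apply/card_gt1P; exists i, j; split; rewrite ?inE // eq_sym.
  case/eqP: Biu; rewrite -(Bsum u) (bigD1 i) //= big1 ?addr0 // => j ji.
  by apply/eqP; have := Z j; rewrite ji negbK.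
have : (\sum_(u : T) 2 <= \sum_(v : T | v != o) 2)%N.
  apply: (@leq_trans (\sum_(u : T) \sum_(v : T) (B v u != 0%R))%N).
    apply: leq_sum => u _; rewrite (leq_trans (col2 u)) // -sum1_card big_mkcond.
    by apply: leq_sum => v _; rewrite inE; case: (_ != _).
  rewrite exchange_big (bigD1 o) //= big1 ?add0n => [|u _]; last by rewrite Bo eqxx.
  apply: leq_sum => v _; rewrite (leq_trans _ (wt v)) // -sum1_card [leqRHS]big_mkcond.
  by apply: leq_sum => u _; rewrite inE; case: (_ != _).
by rewrite !sum_nat_const cardC1; move: N8; case: (#|T|) => // n _; rewrite /=; lia.
Qed.

(* In a column with at most two non-zero entries whose sum is [#|T|] times its
   entry in the row [o], there are none or exactly two such entries. Two such
   columns share a row; three of them form a triangle (whose sums are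
   inconsistent) or share a single row (too far from a row vanishing on them). *)
Lemma few_nonzero_columns (o : T) B :
  (forall u, \sum_v B v u = #|T|%:R * B o u) ->
  (forall c, #|[set v | B v c != 0%R]| <= 2)%N ->
  (forall a b, #|[set v | B v a != B v b]| <= 2)%N ->
  (forall i j, #|[set u | B i u != B j u]| <= 2)%N ->
  (#|cells B| <= 4)%N /\
  forall i a, B i a != 0 -> exists2 j, j != i & B j a != 0.
Proof.
move=> Bsum wt cdist rdist.
have col3 c i j k : B i c != 0 -> B j c != 0 -> B k c != 0 ->
    i != j -> i != k -> j != k -> False.
  by move=> *; apply: (card_le2_contra (wt c) (a := i) (b := j) (c := k)); rewrite ?inE.
have cdist3 a b i j k : B i a != B i b -> B j a != B j b -> B k a != B k b ->
    i != j -> i != k -> j != k -> False.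
  by move=> *; apply: (card_le2_contra (cdist a b) (a := i) (b := j) (c := k)); rewrite ?inE.
have rdist3 i j a b c : B i a != B j a -> B i b != B j b -> B i c != B j c ->
    a != b -> a != c -> b != c -> False.
  by move=> *; apply: (card_le2_contra (rdist i j) (a := a) (b := b) (c := c)); rewrite ?inE.
have second i a : B i a != 0 -> exists2 j, j != i & B j a != 0.
  move=> nz; have [/existsP[j /andP[ji nzj]]|/existsPn Z] :=
    boolP [exists j, (j != i) && (B j a != 0)]; first by exists j.
  have {}Z j : j != i -> B j a = 0 by move=> ji; apply/eqP; have := Z j; rewrite ji negbK.
  have := Bsum a; rewrite (bigD1 i) //= big1 // addr0.
  have [->|oi] := eqVneq o i; last by rewrite (Z o oi) mulr0 => E; rewrite E eqxx in nz.
  move/eqP; rewrite -subr_eq0 -{1}[B i a]mul1r -mulrBl mulf_eq0 (negbTE nz) orbF.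
  by rewrite subr_eq0 (eqr_nat R 1) => /eqP E; move: N8; rewrite -E.
split=> //.
(* Otherwise the two non-zero rows of column [a] and one of column [b] are three rows where these
   columns differ. *)
have meet a b i j : a != b -> B i a != 0 -> B j b != 0 ->
    exists k, B k a != 0 /\ B k b != 0.
  move=> ab nzi nzj.
  have [/existsP[k /andP[ka kb]]|/existsPn Z] := boolP [exists k, (B k a != 0) && (B k b != 0)].
    by exists k.
  have {}Z k : B k a != 0 -> B k b = 0.
    by move=> nz; apply/eqP; have := Z k; rewrite nz negbK.
  have [i' i'i nzi'] := second i a nzi.
  have ja : B j a = 0 by apply/eqP/negPn/negP => /Z E; rewrite E eqxx in nzj.
  exfalso; apply: (cdist3 a b i i' j).
  - by rewrite (Z i).
  - by rewrite (Z i').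
  - by rewrite ja eq_sym.
  - by rewrite eq_sym.
  - by apply: contraNneq nzi => ->; rewrite ja.
  - by apply: contraNneq nzi' => ->; rewrite ja.
have sum2 a i j : B i a != 0 -> B j a != 0 -> i != j ->
    B i a + B j a = #|T|%:R * B o a.
  move=> nzi nzj ij; rewrite -Bsum (bigD1 i) //= (bigD1 j) 1?eq_sym //= big1 ?addr0 //.
  move=> k /andP[ki kj]; apply/eqP/negPn/negP => nzk.
  by apply: (col3 a i j k); rewrite // eq_sym.
have o_zero a i j : B i a != 0 -> B j a != 0 -> i != j -> o != i -> o != j -> B o a = 0.
  move=> nzi nzj ij oi oj; apply/eqP/negPn/negP => nzo.
  by apply: (col3 a o i j).
have no_common i a b c : a != b -> a != c -> b != c ->
    B i a != 0 -> B i b != 0 -> B i c != 0 -> False.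
  move=> ab ac bc nza nzb nzc.
  have [j [ja jb jc]] := avoid_three (ltnW N8) (wt a) (wt b) (wt c).
  move: ja jb jc; rewrite !inE !negbK => /eqP ja /eqP jb /eqP jc.
  by apply: (rdist3 i j a b c); rewrite ?ja ?jb ?jc.
pose K := [set c | [exists v, B v c != 0]].
have K2 : (#|K| <= 2)%N.
  rewrite leqNgt; apply/negP => /card_gt2P[a [b [c [[aK bK cK] [ab bc ca]]]]].
  move: aK bK cK; rewrite !inE => /existsP[ia nza] /existsP[ib nzb] /existsP[ic nzc].
  have [i [ia' ib']] := meet a b _ _ ab nza nzb.
  have [j [jb' jc']] := meet b c _ _ bc nzb nzc.
  have [k [kc' ka']] := meet c a _ _ ca nzc nza.
  have ac : a != c by rewrite eq_sym.
  have ic0 : B i c = 0 by apply/eqP/negPn/negP => /(no_common i a b c ab ac bc ia' ib').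
  have ja0 : B j a = 0 by apply/eqP/negPn/negP => ja; apply: (no_common j a b c).
  have kb0 : B k b = 0 by apply/eqP/negPn/negP => kb; apply: (no_common k a b c).
  have ij : i != j by apply: contraNneq ia' => ->; rewrite ja0.
  have jk : j != k by apply: contraNneq jb' => ->; rewrite kb0.
  have ki : k != i by apply: contraNneq kc' => ->; rewrite ic0.
  have iE : B i a = B i b.
    apply/eqP/negPn/negP => ne; apply: (cdist3 a b i j k) => //; last by rewrite eq_sym.
      by rewrite ja0 eq_sym.
    by rewrite kb0.
  have jE : B j b = B j c.
    apply/eqP/negPn/negP => ne; apply: (cdist3 b c j k i) => //; last by rewrite eq_sym.
      by rewrite kb0 eq_sym.
    by rewrite ic0.
  (* The triangle now carries three values, one per row, with pairwise sums N times an entry of row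
     [o]. Whether [o] is one of [i], [j], [k] or none, these equations force a value to vanish. *)
  have kE : B k c = B k a.
    apply/eqP/negPn/negP => ne; apply: (cdist3 c a k i j) => //; last by rewrite eq_sym.
      by rewrite ic0 eq_sym.
    by rewrite ja0.
  have sa := sum2 a i k ia' ka'; have sb := sum2 b i j ib' jb' ij.
  have sc := sum2 c j k jc' kc' jk; rewrite eq_sym in sa; have {}sa := sa ki.
  have oa := o_zero a i k ia' ka'; rewrite eq_sym in oa; have {}oa := oa ki.
  have ob := o_zero b i j ib' jb' ij; have oc := o_zero c j k jc' kc' jk.
  have [oi|oi] := eqVneq o i.
    case/eqP: kc'; move: sa sb sc; rewrite oi ic0 iE jE kE; lra.
  have [oj|oj] := eqVneq o j.
    case/eqP: ia'; move: sa sb sc; rewrite oj ja0 iE jE kE; lra.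
  have [ok|ok] := eqVneq o k.
    case/eqP: jb'; move: sa sb sc; rewrite ok kb0 iE jE kE; lra.
  case/eqP: ia'; move: sa sb sc; rewrite oa // ob // oc // iE jE kE; lra.
rewrite -sum1_card (partition_big (fun c : T * T => c.2) (mem K)) /=; last first.
  by move=> [v c]; rewrite !inE /= => nz; apply/existsP; exists v.
apply: (@leq_trans (\sum_(c in K) 2)%N); last by rewrite sum_nat_const; lia.
apply: leq_sum => c _; apply: leq_trans (wt c).
rewrite sum1_card -[leqRHS](card_imset _ (_ : injective (fun v => (v, c)))); last by move=> v u [].
apply/subset_leq_card/subsetP => -[v d]; rewrite unfold_in inE /=.
by move=> /andP[nz /eqP <-]; apply/imsetP; exists v; rewrite ?inE.
Qed.

Lemma small_Supp (o : T) A f :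
  (forall u, A o u = 0) -> (forall u, \sum_v A v u = 0) ->
  (forall p, f p = \sum_v A v (p v)) -> (exists p, f p != 0) ->
  (#|Supp f| <= 2 * (#|T| - 1)`!)%N ->
  exists c u v w, [/\ c != 0, v != o, w != o, v != w &
    forall p, f p = c * (if p v == u then 1 else if p w == u then -1 else 0)].
Proof.
move=> Ao Asum fA [p0 fp0] small.
have N7 := ltnW N8.
have fA0 p : f p = 0 + \sum_v A v (p v) by rewrite add0r.
have [r rE] : exists r : T -> R, forall v, (#|[set u | (A v u - A o u)%R != r v]| <= 2)%N.
  apply: (@fin_all_exists T (fun=> R)
    (fun v z => (#|[set u | (A v u - A o u)%R != z]| <= 2)%N)) => v.
  exact: row_differences fA0 small v o.
(* [r v] is the value row [v] takes with at most two exceptions; the subtracted constants add up to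
   [C]. *)
pose B v u := A v u - r v; pose C := \sum_v r v.
have wtB i : (#|[set u | B i u != 0%R]| <= 2)%N.
  apply: leq_trans (rE i); apply/eq_leq/eq_card => u.
  by rewrite !inE Ao subr0 subr_eq0.
have distB i j : (#|[set u | B i u != B j u]| <= 2)%N.
  have [z zE] := row_differences fA0 small i j.
  apply: (sparse_sub_const (z := z - r i + r j)) => //.
  apply: leq_trans zE; apply/eq_leq/eq_card => u; rewrite !inE; congr negb.
  by rewrite /B; apply/eqP/eqP; lra.
have ro : r o = 0.
  have [u [+ _ _]] := avoid_three N7 (rE o) (rE o) (rE o).
  by rewrite inE negbK subrr => /eqP.
have Bo u : B o u = 0 by rewrite /B Ao ro subr0.
have BC u : \sum_v B v u = - C by rewrite sumrB Asum sub0r.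
have fB p : f p = C + \sum_v B v (p v) by rewrite fA sumrB addrC subrK.
have C0 : C = 0.
  apply/eqP/negPn/negP => C0.
  by have := nonzero_constant_large_Supp fB Bo BC C0 wtB distB; rewrite ltnNge small.
have Bsum u : \sum_v B v u = 0 by rewrite BC C0 oppr0.
have [a0 Ba0] := zero_column Bo Bsum wtB.
have cdB := column_differences fB small.
have [z zE] : exists z : T -> R, forall c, (#|[set v | (B v c - B v a0)%R != z c]| <= 2)%N.
  apply: (@fin_all_exists T (fun=> R)
    (fun c z => (#|[set v | (B v c - B v a0)%R != z]| <= 2)%N)) => c.
  exact: cdB.
(* Since column [a0] vanishes, column [c] itself equals [z c] up to two exceptions. *)
pose B' v c := B v c - z c.
have wtB' c : (#|[set v | B' v c != 0%R]| <= 2)%N.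
  apply: leq_trans (zE c); apply/eq_leq/eq_card => v.
  by rewrite !inE Ba0 subr0 subr_eq0.
have B'o c : B' o c = - z c by rewrite /B' Bo sub0r.
have B'sum c : \sum_v B' v c = #|T|%:R * B' o c.
  by rewrite sumrB Bsum sumr_const sub0r B'o mulrN mulr_natl.
have fB' p : f p = \sum_c z c + \sum_v B' v (p v).
  rewrite fB C0 add0r [X in X + _](reindex_inj (@perm_inj _ p)) /=.
  by rewrite -big_split; apply: eq_bigr => v _; rewrite [RHS]addrC /B' subrK.
have cdistB' a b : (#|[set v | B' v a != B' v b]| <= 2)%N.
  have [y yE] := cdB a b; apply: (sparse_sub_const (z := y - z a + z b)) => //.
  apply: leq_trans yE; apply/eq_leq/eq_card => v; rewrite !inE; congr negb.
  by rewrite /B'; apply/eqP/eqP; lra.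
have rdistB' i j : (#|[set u | B' i u != B' j u]| <= 2)%N.
  apply: leq_trans (distB i j); apply/eq_leq/eq_card => u; rewrite !inE; congr negb.
  by rewrite /B'; apply/eqP/eqP; lra.
have [cells4 second] := few_nonzero_columns B'sum wtB' cdistB' rdistB'.
have [z0 cells2] : \sum_c z c = 0 /\ (#|cells B'| <= 2)%N.
  by apply: few_cells fB' N8 _ small; move: cells4 N8; lia.
have [i [a nzi]] : exists i a, B' i a != 0.
  have [/existsP[i /existsP[a nz]]|/existsPn Z] := boolP [exists i, exists a, B' i a != 0].
    by exists i, a.
  case/eqP: fp0; rewrite fB' z0 add0r big1 // => v _; apply/eqP.
  by have /existsPn/(_ (p0 v)) := Z v; rewrite negbK.
have [j ji nzj] := second i a nzi.
have other v c : (v, c) != (i, a) -> (v, c) != (j, a) -> B' v c = 0.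
  move=> ne_i ne_j; apply/eqP/negPn/negP => nz.
  apply: (card_le2_contra cells2 (a := (v, c)) (b := (i, a)) (c := (j, a)));
    by rewrite ?inE // xpair_eqE eqxx andbT eq_sym.
(* All cells lie in column [a], so [z c], the negative of [B' o c], is 0 for [c != a]; the total
   being 0 gives [z a = 0]. Hence neither cell lies in row [o], and the zero column sum makes them
   opposite. *)
have za : z a = 0.
  rewrite -[RHS]z0 (bigD1 a) //= big1 ?addr0 // => c ca.
  by apply/oppr_inj; rewrite -B'o oppr0 other // xpair_eqE (negbTE ca) andbF.
have B'oa : B' o a = 0 by rewrite B'o za oppr0.
have io : i != o by apply: contraNneq nzi => ->; rewrite B'oa.
have jo : j != o by apply: contraNneq nzj => ->; rewrite B'oa.
have nzE v u : v != i -> v != j -> B' v u = 0.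
  by move=> vi vj; rewrite other // xpair_eqE ?(negbTE vi) ?(negbTE vj).
have jE : B' j a = - B' i a.
  have := B'sum a; rewrite B'oa mulr0 (bigD1 i) //= (bigD1 j) //= big1 ?addr0.
    by move/eqP; rewrite addrC addr_eq0 => /eqP.
  by move=> v /andP[vi vj]; rewrite nzE.
exists (B' i a), a, i, j; split=> //; first by rewrite eq_sym.
move=> p; rewrite fB' z0 add0r (bigD1 i) //= (bigD1 j) //= big1 ?addr0; last first.
  by move=> v /andP[vi vj]; rewrite nzE.
have off v : p v != a -> B' v (p v) = 0.
  by move=> pva; rewrite other // xpair_eqE (negbTE pva) andbF.
have [pi|pi] := eqVneq (p i) a.
  rewrite pi off ?addr0 ?mulr1 //; apply: contraNneq ji => pj.
  by apply/eqP/(@perm_inj _ p); rewrite pj.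
rewrite (off i pi) add0r; have [->|pj] := eqVneq (p j) a; last by rewrite off // mulr0.
by rewrite jE mulrN1.
Qed.

End SmallSupport.

(** * Three points *)

(** If [t] is injective, f vanishes nowhere and its support has 6 > 4 elements. Otherwise [t] is
    constant off one point [u], and f is a multiple of the function attached to [u]. *)
Lemma small_Supp3 (R : realType) (A : 'I_3 -> 'I_3 -> R) (f : 'S_3 -> R) :
  (forall u, A ord0 u = 0) -> (forall u, \sum_v A v u = 0) ->
  (forall p : 'S_3, f p = \sum_v A v (p v)) -> (exists p, f p != 0) ->
  (#|Supp f| <= 4)%N ->
  exists c u v w, [/\ c != 0, v != ord0, w != ord0, v != w &
    forall p : 'S_3, f p = c * (if p v == u then 1 else if p w == u then -1 else 0)].
Proof.
move=> Ao Asum fA [p0 fp0] small.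
pose v : 'I_3 := inord 1; pose w : 'I_3 := inord 2.
have v0 : v != ord0 by rewrite -val_eqE /= inordK.
have w0 : w != ord0 by rewrite -val_eqE /= inordK.
have vw : v != w by rewrite -val_eqE /= !inordK.
have E3 (x : 'I_3) : [\/ x = ord0, x = v | x = w].
  case: x => -[|[|[|//]]] lt3; [apply: Or31 | apply: Or32 | apply: Or33];
    by apply: val_inj; rewrite /= ?inordK.
have sum3 (F : 'I_3 -> R) : \sum_x F x = F ord0 + (F v + F w).
  rewrite (bigD1 ord0) //= (bigD1 v) //= (bigD1 w) /=; last by rewrite w0 eq_sym.
  by rewrite big1 ?addr0 // => x; case: (E3 x) => ->; rewrite ?eqxx ?andbF.
pose t u := A v u.
have fE (p : 'S_3) : f p = t (p v) - t (p w).
  rewrite fA sum3 Ao add0r; have := Asum (p w); rewrite sum3 Ao /t; lra.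
have [/injectivePn[a [b ab tab]]|inj] := boolP (~~ injectiveb t); last first.
  move: inj; rewrite negbK => /injectiveP inj.
  have : (#|{: 'S_3}| <= #|Supp f|)%N.
    rewrite -cardsT; apply/subset_leq_card/subsetP => p _.
    by rewrite inE fE subr_eq0 (inj_eq inj) (inj_eq perm_inj).
  by rewrite card_permT card_ord => /leq_trans/(_ small).
have [u [ua ub]] : exists u : 'I_3, u != a /\ u != b.
  have /subsetPn[u _] : ~~ ([set: 'I_3] \subset [set a; b]).
    by apply/negP => /subset_leq_card; rewrite cardsT card_ord cards2; case: (_ != _).
  by rewrite !inE negb_or => /andP[]; exists u.
have tE x : x != u -> t x = t a.
  move=> xu; have [->//|xa] := eqVneq x a; have [->//|xb] := eqVneq x b.
  have : uniq [:: u; x; a; b] by rewrite /= !inE !negb_or eq_sym xu ua ub xa xb ab.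
  by move/card_uniqP => /= E; have := max_card (mem [:: u; x; a; b]); rewrite E card_ord.
exists (t u - t a), u, v, w; split=> //.
  rewrite subr_eq0; apply: contra fp0 => /eqP tu; rewrite fE subr_eq0.
  have tc x : t x = t a by have [->|/tE] := eqVneq x u.
  by rewrite !tc.
move=> p; rewrite fE; have [pv|pv] := eqVneq (p v) u.
  rewrite pv mulr1 (tE (p w)) // -pv (inj_eq perm_inj) eq_sym //.
have [->|pw] := eqVneq (p w) u; first by rewrite tE // mulrN1 opprB.
by rewrite (tE _ pv) (tE _ pw) subrr mulr0.
Qed.

(** * Translation to the Star graph *)

Theorem theorem2 (R : realType) (n : nat) (hn : (8 <= n)%N \/ n = 3%N)
    (f : 'S_n -> R) (hf : eigenfunction (@star_graph n) (n%:R - 2) f) :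
  (2 * (n - 1)`! <= #|Supp f|)%N /\
  (#|Supp f| = (2 * (n - 1)`!)%N <->
   exists c : R, c != 0 /\
     exists g : 'S_n -> R, star_family g /\ forall p : 'S_n, f p = c * g p).
Proof.
have N : (2 < n)%N by case: hn; lia.
pose o : 'I_n := Ordinal (ltnW (ltnW N)).
have oE (i : 'I_n) : (val i == 0%N) = (i == o) by rewrite -val_eqE.
have [[p0 fp0] feig] := hf.
have nbrs x : neighbours (@star_graph n) x = [set (tperm o i * x)%g | i in [pred i | i != o]].
  apply/setP => y; rewrite !inE /star_graph /cayley_graph inE.
  apply/existsP/imsetP => [[i /existsP[j /and3P[]]]|[i io ->]].
    rewrite !oE => /eqP-> jo /eqP xy; exists j => //.
    by rewrite -[tperm o j]tpermV -xy invMg invgK mulgKV.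
  exists o; apply/existsP; exists i; rewrite !oE eqxx (_ : i != o) //=.
  by rewrite invMg tpermV mulKVg.
have [A [Ao Asum fA]] : exists A : 'I_n -> 'I_n -> R,
    [/\ forall u, A o u = 0, forall u, \sum_v A v u = 0 & forall x, f x = \sum_v A v (x v)].
  apply: star_eigen_additive => [|x]; rewrite card_ord; first exact: ltnW.
  rewrite feig nbrs big_imset //= => i j _ _ /mulIg /permP/(_ o).
  by rewrite !tpermL.
have fam c u v w : [/\ c != 0, v != o, w != o, v != w &
    forall p, f p = c * (if p v == u then 1 else if p w == u then -1 else 0)] ->
    exists c : R, c != 0 /\
      exists g : 'S_n -> R, star_family g /\ forall p : 'S_n, f p = c * g p.
  move=> [c0 vo wo vw fc]; exists c; split=> //; exists (star_fun R u v w); split=> //.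
  by exists u, v, w; rewrite !oE.
have Supp_fam : (exists c : R, c != 0 /\
      exists g : 'S_n -> R, star_family g /\ forall p : 'S_n, f p = c * g p) ->
    #|Supp f| = (2 * (n - 1)`!)%N.
  move=> [c [c0 [g [[u [v [w [_ _ vw gE]]]] fc]]]].
  rewrite -(card_Supp_star R u vw); apply: eq_card => p.
  by rewrite !inE fc gE mulf_eq0 (negbTE c0).
have small : (#|Supp f| <= 2 * (n - 1)`!)%N -> exists c : R, c != 0 /\
      exists g : 'S_n -> R, star_family g /\ forall p : 'S_n, f p = c * g p.
  move=> le; suff [c [u [v [w]]]] : exists c u v w, [/\ c != 0, v != o, w != o, v != w &
      forall p, f p = c * (if p v == u then 1 else if p w == u then -1 else 0)] by apply: fam.
  case: hn => [n8|n3].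
    by apply: (small_Supp _ Ao Asum fA); [rewrite card_ord | exists p0 | rewrite card_ord].
  subst n; have o0 : o = ord0 by apply: val_inj.
  by rewrite o0 in Ao *; apply: (small_Supp3 Ao Asum fA) => //; exists p0.
split; last by split=> [E|]; [apply: small; rewrite E | exact: Supp_fam].
(* A support below the bound would put f in the family, whose members attain the bound exactly. *)
by rewrite leqNgt; apply/negP => lt; have := Supp_fam (small (ltnW lt)); lia.
Qed.
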